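(* If $G=\mathbb{Z}$ (discrete) or $G=\mathbb{R}$ (usual topology), then the action $G\curvearrowright M_a$ of $G$ on its canonical universal a.a. space $M_a$ is free; that is, $tx\neq x$ for all $x\in M_a$ and all $t\in G$ with $t\neq0$.
   Context: For $f:G\to\mathbb{C}$ and $t\in G$ let $(ft)(x)=f(tx)$ and $(tf)(x)=f(xt)$ (group operation written multiplicatively). $\mathrm{LUC}(G)$ is the set of bounded continuous $f:G\to\mathbb{C}$ such that $ft_n\to ft$ uniformly on $G$ whenever $t_n\to t$ in $G$. $f\in\mathrm{A}_{c,L}(G)$ (left almost automorphic) if every net $\{t_n\}$ in $G$ has a subnet $\{t_{n'}\}$ and there is some continuous $\phi:G\to\mathbb{C}$ with $t_{n'}f\to\phi$ and $t_{n'}^{-1}\phi\to f$ pointwise on $G$. Put $\mathbb{V}=\mathrm{A}_{c,L}(G)\cap\mathrm{LUC}(G)$, a norm closed subalgebra of the bounded continuous functions, with $ft\in\mathbb V$ for $f\in\mathbb V$, $t\in G$. For $t\in G$ let $t^*\in\mathbb{V}^*$ be $f\mapsto f(t)$. $M_a$ is the weak-$*$ closure of $\{t^*:t\in G\}$ in $\mathbb{V}^*$, with the (jointly continuous) action $(t\mu)(f)=\mu(ft)$. *)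

(* Defs.v *)
From HB Require Import structures.
From mathcomp Require Import all_boot all_order all_algebra.
From mathcomp Require Import complex.
From mathcomp Require Import all_classical all_reals all_analysis.

Set Implicit Arguments.
Unset Strict Implicit.
Unset Printing Implicit Defensive.

Import Order.TTheory GRing.Theory Num.Theory.
Import numFieldNormedType.Exports.

Local Open Scope classical_set_scope.
Local Open Scope ring_scope.
Local Open Scope complex_scope.

(* The usual topology and norm on the complex numbers. *)
HB.instance Definition _ (R : rcfType) := NormedModule.copy R[i] (R[i])^o.

(* The discrete topological group on an abelian group. *)
HB.instance Definition _ (T : zmodType) :=
  GRing.Zmodule.copy (discrete_topology T) T.

Lemma discrete_sub_continuous (T : zmodType) :
  continuous (fun x : discrete_topology T * discrete_topology T => x.1 - x.2).
Proof.
move=> [a b] /= A /nbhs_singleton/= Aab.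
exists ([set a], [set b]); first by split; exact: discrete_set1.
by move=> [x y] /= [-> ->].
Qed.

HB.instance Definition _ (T : zmodType) :=
  PreTopologicalNmodule_isTopologicalZmodule.Build (discrete_topology T)
    (@discrete_sub_continuous T).

Record directedType := DirectedType {
  dir_sort :> Type;
  dir_le : dir_sort -> dir_sort -> Prop;
  dir_inhabited : inhabited dir_sort;
  dir_refl : forall d, dir_le d d;
  dir_trans : forall d1 d2 d3, dir_le d1 d2 -> dir_le d2 d3 -> dir_le d1 d3;
  dir_ub : forall d1 d2, exists d, dir_le d1 d /\ dir_le d2 d }.

(* A net in T is a function t : D -> T with D directed; it converges to l when
   t d @[d --> dir_tails D] --> l. *)
Definition dir_tails (D : directedType) : set_system D :=
  [set A | exists d0, forall d, dir_le d0 d -> A d].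

Arguments dir_tails : clear implicits.

Global Instance dir_tails_filter (D : directedType) :
  ProperFilter (dir_tails D).
Proof.
split; first by move=> [d /(_ d (dir_refl d))].
split.
- by case: (dir_inhabited D) => d; exists d.
- move=> P Q [dP HP] [dQ HQ]; have [d [Pd Qd]] := dir_ub dP dQ.
  by exists d => e de; split; [apply: HP|apply: HQ]; apply: dir_trans de.
- by move=> P Q PQ [d Hd]; exists d => e /Hd /PQ.
Qed.

(* The subnets of a net t : D -> T are the t \o h with h cofinal. *)
Definition cofinal (D' D : directedType) (h : D' -> D) : Prop :=
  forall d0, exists d0', forall d', dir_le d0' d' -> dir_le d0 (h d').

Lemma cofinal_tails (D' D : directedType) (h : D' -> D) :
  cofinal h -> h d @[d --> dir_tails D'] `=>` dir_tails D.
Proof.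
move=> hc A [d0 Ad0]; have [d0' Hd0'] := hc d0.
by exists d0' => d' /Hd0'; exact: Ad0.
Qed.

Lemma cofinal_comp (D'' D' D : directedType) (h : D' -> D) (k : D'' -> D') :
  cofinal h -> cofinal k -> cofinal (h \o k).
Proof.
move=> hc kc d0; have [d1 H1] := hc d0; have [d2 H2] := kc d1.
by exists d2 => d /H2 /H1.
Qed.

Section almost_automorphic.
Variables (R : realType) (G : topologicalZmodType).

(* G is abelian and written additively, but the side on which t acts is kept:
   ltrans t f is ft and rtrans t f is tf. *)
Definition ltrans (t : G) (f : G -> R[i]) : G -> R[i] := fun x => f (t + x).
Definition rtrans (t : G) (f : G -> R[i]) : G -> R[i] := fun x => f (x + t).

Definition LUC (f : G -> R[i]) : Prop :=
  [/\ bounded_fun f, continuous f &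
    forall (D : directedType) (u : D -> G) (t : G),
      u d @[d --> dir_tails D] --> t ->
      {uniform, ltrans (u d) f @[d --> dir_tails D] --> ltrans t f}].

Definition left_aa (f : G -> R[i]) : Prop :=
  forall (D : directedType) (u : D -> G),
  exists (D' : directedType) (h : D' -> D) (phi : G -> R[i]),
    [/\ cofinal h, continuous phi,
      {ptws, rtrans (u (h d)) f @[d --> dir_tails D'] --> phi} &
      {ptws, rtrans (- u (h d)) phi @[d --> dir_tails D'] --> f}].

Definition aa_luc_pred : {pred G -> R[i]} :=
  [pred f | `[< left_aa f /\ LUC f >]].

Lemma ptws_cvgP (I T : Type) (F : set_system I) (FF : Filter F)
    (u : I -> T -> R[i]) (l : T -> R[i]) :
  {ptws, u i @[i --> F] --> l} <-> forall x : T, u i x @[i --> F] --> l x.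
Proof.
rewrite cvg_sup; split => H x.
  move: (H x); rewrite cvg_image; last first.
    by rewrite eqEsubset; split=> v // _; exists (cst v).
  move=> H1 A /H1/= [B HB <-]; apply: (@filterS _ F _ _ _ _ HB) => i Bi.
  by exists (u i).
rewrite cvg_image; last by rewrite eqEsubset; split=> v // _; exists (cst v).
move=> A /(H x) HA; exists (@^~ x @^-1` A) => //.
by rewrite eqEsubset; split => [_ [? ? <-]//|j Aj]; exists (fun=> j).
Qed.

Lemma uniform_cvgP (D : directedType) (F : D -> G -> R[i])
    (f : G -> R[i]) :
  {uniform, F d @[d --> dir_tails D] --> f} <->
  forall e : R[i], 0 < e ->
    \forall d \near dir_tails D, forall x, `|f x - F d x| < e.
Proof.
split=> [H e e0|H A /uniform_nbhs[E [+ EA]]].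
  apply: (H [set h | forall x, `|f x - h x| < e]); apply/uniform_nbhs.
  exists [set xy | `|xy.1 - xy.2| < e]; split; first exact: entourage_ball (PosNum e0).
  by move=> h /= Hh x; exact: Hh.
rewrite -entourage_ballE => -[e /= e0 eE].
apply: (@filterS _ (dir_tails D) _ _ _ _ (H e e0)) => d Hd; apply: EA => y _; apply: eE => /=.
exact: Hd.
Qed.

Lemma bounded_funC (f : G -> R[i]) :
  bounded_fun f <-> exists M : R, forall x, `|f x| <= M%:C.
Proof.
have PF : ProperFilter (globally [set: G]).
  exact: (@globally_properfilter _ _ 0).
rewrite /= ex_bound; split=> [[M HM]|[M HM]]; last by exists M%:C => x _; exact: HM.
have M0 : 0 <= M by apply: le_trans (HM 0 Logic.I).
exists (complex.Re M) => x; apply: le_trans (HM x Logic.I) _.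
by rewrite RRe_real// ger0_real.
Qed.

Lemma aa_luc_submod : submod_closed aa_luc_pred.
Proof.
split=> [|a f g].
  apply/asboolP; split=> [D u|]; [exists D, id, 0|]; split.
  - by move=> d; exists d.
  - by move=> x; exact: cvg_cst.
  - by apply/ptws_cvgP => x; exact: cvg_cst.
  - by apply/ptws_cvgP => x; exact: cvg_cst.
  - by apply/bounded_funC; exists 0 => x; rewrite normr0.
  - by move=> x; exact: cvg_cst.
  move=> D u t _; apply/uniform_cvgP => e e0; apply: nearW => d x.
  by rewrite /ltrans subrr normr0.
move=> /asboolP[Lf [Bf Cf Uf]] /asboolP[Lg [Bg Cg Ug]]; apply/asboolP; split.
  move=> D u; have [D1 [h1 [p1 [c1 k1 A1 B1]]]] := Lf D u.
  have [D2 [h2 [p2 [c2 k2 A2 B2]]]] := Lg D1 (u \o h1).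
  exists D2, (h1 \o h2), (a *: p1 + p2); split.
  - exact: cofinal_comp.
  - move=> x; apply: cvgD; last exact: k2.
    by apply: cvgZr; exact: k1.
  - apply/ptws_cvgP => x; apply: cvgD.
      apply: cvgZr; move/ptws_cvgP: A1 => /(_ x).
      by apply: (cvg_comp _ _ (cofinal_tails c2)).
    by move/ptws_cvgP: A2; exact.
  - apply/ptws_cvgP => x; apply: cvgD.
      apply: cvgZr; move/ptws_cvgP: B1 => /(_ x).
      by apply: (cvg_comp _ _ (cofinal_tails c2)).
    by move/ptws_cvgP: B2; exact.
split.
- move/bounded_funC: Bf => [M HM]; move/bounded_funC: Bg => [N HN].
  have PF : ProperFilter (globally [set: G]).
    exact: (@globally_properfilter _ _ 0).
  apply/ex_bound; exists (`|a| * M%:C + N%:C) => x _ /=.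
  rewrite (le_trans (ler_normD _ _))// lerD// normrM ler_wpM2l//.
- move=> x; apply: cvgD; last exact: Cg.
  by apply: cvgZr; exact: Cf.
move=> D u t ut; apply/uniform_cvgP => e e0.
have e2 : 0 < e / 2 by rewrite divr_gt0.
have ea : 0 < e / 2 / (1 + `|a|) by rewrite divr_gt0// ltr_pwDl.
have /uniform_cvgP/(_ _ ea) Hf := Uf D u t ut.
have /uniform_cvgP/(_ _ e2) Hg := Ug D u t ut.
apply: filterS2 Hf Hg => d Hf Hg x.
have -> : ltrans t (a *: f + g) x - ltrans (u d) (a *: f + g) x =
    a * (ltrans t f x - ltrans (u d) f x) + (ltrans t g x - ltrans (u d) g x).
  by rewrite mulrBr opprD addrACA.
rewrite (le_lt_trans (ler_normD _ _))// [ltRHS](splitr e) ler_ltD//.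
rewrite normrM; apply: le_trans (ler_wpM2l (normr_ge0 a) (ltW (Hf x))) _.
rewrite mulrCA; apply: ler_piMr; first exact: ltW.
by rewrite ler_pdivrMr ?ltr_pwDl// mul1r lerDr.
Qed.

Lemma addl_continuous (t : G) : continuous (fun y : G => t + y).
Proof.
move=> x; apply: (@continuous_comp _ _ _ (fun y => (t, y)) (fun z : G * G => z.1 + z.2)).
  by apply: cvg_pair => /=; [exact: cvg_cst|exact: cvg_id].
exact: add_continuous.
Qed.

Lemma ltransD (s t : G) (f : G -> R[i]) :
  ltrans s (ltrans t f) = ltrans (t + s) f.
Proof. by apply/funext => x; rewrite /ltrans addrA. Qed.

Lemma ltrans_rtrans (s t : G) (f : G -> R[i]) :
  rtrans s (ltrans t f) = ltrans t (rtrans s f).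
Proof. by apply/funext => x; rewrite /ltrans /rtrans addrA. Qed.

Lemma ltrans_aa_luc (t : G) (f : G -> R[i]) :
  f \in aa_luc_pred -> ltrans t f \in aa_luc_pred.
Proof.
have tc g : continuous g -> continuous (ltrans t g).
  by move=> gc x; exact: continuous_comp (@addl_continuous t x) (gc _).
move=> /asboolP[Lf [Bf Cf Uf]]; apply/asboolP; split.
  move=> D u; have [D1 [h1 [p1 [c1 k1 A1 B1]]]] := Lf D u.
  exists D1, h1, (ltrans t p1); split; [exact: c1|exact: tc| |].
  - apply/ptws_cvgP => x; under eq_fun do rewrite ltrans_rtrans.
    by move/ptws_cvgP: A1; exact.
  - apply/ptws_cvgP => x; under eq_fun do rewrite ltrans_rtrans.
    by move/ptws_cvgP: B1; exact.
split; [|exact: tc|].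
- move/bounded_funC: Bf => [M HM].
  by apply/bounded_funC; exists M => x; exact: HM.
move=> D u s us; rewrite ltransD; under eq_fun do rewrite ltransD.
by apply: Uf; apply: (cvg_comp _ _ us); exact: addl_continuous.
Qed.

HB.instance Definition _ :=
  GRing.isSubmodClosed.Build R[i] (G -> R[i]) aa_luc_pred aa_luc_submod.

Record aa_luc : Type :=
  AALuc { aa_luc_fun :> G -> R[i]; aa_lucP : aa_luc_fun \in aa_luc_pred }.

HB.instance Definition _ := [isSub for aa_luc_fun].
HB.instance Definition _ := [Choice of aa_luc by <:].
HB.instance Definition _ := [SubChoice_isSubLmodule of aa_luc by <:].

(* `|f x| is a (real) element of R[i], whence the real part under the sup. *)
Definition sup_norm (f : aa_luc) : R[i] :=
  (sup (range (fun x => complex.Re `|f x|)))%:C.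

Lemma sup_norm_le (f : aa_luc) (M : R[i]) :
  (forall x, `|f x| <= M) -> sup_norm f <= M.
Proof.
move=> fM; have M0 : 0 <= M by apply: le_trans (fM 0).
rewrite /sup_norm -(RRe_real (ger0_real M0)) lecR; apply: ge_sup.
  by exists (complex.Re `|f 0|); exists 0.
by move=> _ [x _ <-]; rewrite -lecR !RRe_real ?ger0_real.
Qed.

Lemma le_sup_norm (f : aa_luc) x : `|f x| <= sup_norm f.
Proof.
have /asboolP[_ [/bounded_funC[M HM] _ _]] := aa_lucP f.
rewrite /sup_norm -(RRe_real (normr_real (f x))) lecR; apply: ub_le_sup.
  by exists M => _ [y _ <-]; rewrite -lecR RRe_real ?ger0_real.
by exists x.
Qed.

Lemma sup_normD (f g : aa_luc) : sup_norm (f + g) <= sup_norm f + sup_norm g.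
Proof.
apply: sup_norm_le => x; apply: le_trans (ler_normD _ _) _.
by apply: lerD; exact: le_sup_norm.
Qed.

Lemma sup_normZ (a : R[i]) (f : aa_luc) :
  sup_norm (a *: f) = `|a| * sup_norm f.
Proof.
apply/le_anti/andP; split.
  apply: sup_norm_le => x; have -> : (a *: f) x = a * f x by [].
  by rewrite normrM ler_wpM2l// le_sup_norm.
have [->|a0] := eqVneq a 0.
  rewrite normr0 mul0r; apply: le_trans (normr_ge0 _) (le_sup_norm _ 0).
rewrite -ler_pdivlMl ?normr_gt0//; apply: sup_norm_le => x.
by rewrite ler_pdivlMl ?normr_gt0// -normrM; exact: (le_sup_norm (a *: f)).
Qed.

Lemma sup_norm_eq0 (f : aa_luc) : sup_norm f = 0 -> f = 0.
Proof.
move=> f0; apply/val_inj/funext => x; apply/eqP.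
by rewrite -normr_le0 -f0 le_sup_norm.
Qed.

HB.instance Definition _ :=
  Lmodule_isNormed.Build R[i] aa_luc sup_normD sup_normZ sup_norm_eq0.

(* The continuous dual of aa_luc, with the weak-* topology, that is,
   the subspace topology of pointwise convergence on aa_luc. *)
Definition aa_dual : Type :=
  [set mu : {ptws aa_luc -> R[i]} |
    linear (mu : aa_luc -> R[i]) /\ continuous (mu : aa_luc -> R[i])].
HB.instance Definition _ := Topological.on aa_dual.

Definition dual_app (mu : aa_dual) : aa_luc -> R[i] := set_val mu.
Coercion dual_app : aa_dual >-> Funclass.

Lemma dualP (mu : aa_dual) : linear mu /\ continuous mu.
Proof. by case: mu => m mP; exact: (set_mem mP). Qed.

Lemma linear_contraction_continuous (V : normedModType R[i])
    (mu : aa_luc -> V) :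
  linear mu -> (forall f, `|mu f| <= `|f|) -> continuous mu.
Proof.
move=> muL mu1 f; apply/(@cvgrPdist_lt _ _ _ (nbhs f)) => e e0.
have : \forall g \near f, `|f - g| < e by exact: (@cvgr_dist_lt _ _ _ (nbhs f) _ id f cvg_id _ e0).
apply: filterS => g; apply: le_lt_trans.
have -> : mu f - mu g = mu (f - g).
  by rewrite [f - g]addrC -[- g]scaleN1r muL scaleN1r addrC.
exact: mu1.
Qed.

Lemma ev_dual_subproof (t : G) :
  linear (fun f : aa_luc => f t) /\ continuous (fun f : aa_luc => f t).
Proof.
have L : linear (fun f : aa_luc => f t) by [].
split; first exact: L.
by apply: linear_contraction_continuous L _ => f; exact: le_sup_norm.
Qed.

(* t^* *)
Definition ev_dual (t : G) : aa_dual := SigSub (mem_set (ev_dual_subproof t)).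

Definition M_a : set aa_dual := closure (range ev_dual).

Definition aa_ltrans (t : G) (f : aa_luc) : aa_luc :=
  AALuc (ltrans_aa_luc t (aa_lucP f)).

Lemma aa_ltrans_linear (t : G) : linear (aa_ltrans t).
Proof. by move=> a f g; exact: val_inj. Qed.

Lemma aa_ltrans_continuous (t : G) : continuous (aa_ltrans t).
Proof.
apply: linear_contraction_continuous (aa_ltrans_linear t) _ => f.
by apply: sup_norm_le => x; exact: (le_sup_norm f (t + x)).
Qed.

Lemma dual_act_subproof (t : G) (mu : aa_dual) :
  linear (fun f => mu (aa_ltrans t f)) /\
  continuous (fun f => mu (aa_ltrans t f)).
Proof.
have [muL muC] := dualP mu; split=> [a f g|f].
  by rewrite -muL aa_ltrans_linear.
exact: continuous_comp (@aa_ltrans_continuous t f) (muC _).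
Qed.

(* (t mu)(f) = mu(ft) *)
Definition dual_act (t : G) (mu : aa_dual) : aa_dual :=
  SigSub (mem_set (dual_act_subproof t mu)).

Lemma dual_act_continuous (t : G) : continuous (dual_act t).
Proof.
have evc (f : aa_luc) : continuous (fun mu : aa_dual => mu f).
  move=> mu; apply: (@continuous_comp _ _ _
    (set_val : aa_dual -> {ptws aa_luc -> R[i]}) (fun m => m f)).
    exact: initial_continuous.
  exact: proj_continuous.
have actc : continuous
    (fun mu => set_val (dual_act t mu) : {ptws aa_luc -> R[i]}).
  move=> mu.
  apply: (ptws_cvgP (nbhs_filter mu)
    (fun nu f => dual_app nu (aa_ltrans t f)) (dual_app (dual_act t mu))).2.
  move=> f; exact: (evc (aa_ltrans t f) mu).
apply/continuousP => _ [W oW <-].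
by move/continuousP : actc => /(_ W oW).
Qed.

Lemma dual_act_ev (t s : G) : dual_act t (ev_dual s) = ev_dual (t + s).
Proof. exact: val_inj. Qed.

Lemma dual_act_M_a (t : G) (mu : aa_dual) : M_a mu -> M_a (dual_act t mu).
Proof.
move=> Mmu B /dual_act_continuous/Mmu [_ [[s _ <-] Bs]].
by exists (ev_dual (t + s)); split; [exists (t + s)|rewrite -dual_act_ev].
Qed.

End almost_automorphic.

(* Main.v *)
Require Import Defs.
From mathcomp Require Import all_boot all_order all_algebra.
From mathcomp Require Import complex.
From mathcomp Require Import all_classical all_reals all_analysis.

Set Implicit Arguments.
Unset Strict Implicit.
Unset Printing Implicit Defensive.

Import Order.TTheory GRing.Theory Num.Theory.
Import numFieldNormedType.Exports.

Local Open Scope classical_set_scope.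
Local Open Scope ring_scope.
Local Open Scope complex_scope.

(** The idea is that a point of [M_a] fixed by [t] cannot exist as soon as some
unimodular [f] in the algebra of left almost automorphic functions in [LUC]
satisfies [ft = - f].  Indeed [mu(ft) = mu(f)] would give [mu(f) = 0], whereas
[mu(f)] is a limit of values of [f], hence has modulus one ([M_a_neq0]).  Such
an [f] is provided by a character [x |-> exp(i theta(x))], where [theta] is a
continuous additive map from the group to the reals with [theta(t) = pi]
([dual_act_neq]); for the integers and for the reals, [theta(x) = (pi / t) x]
does.

That characters are left almost automorphic ([left_aa_character]) comes from the
compactness of the circle: along a subnet of [u] the phase [theta(u)] converges
modulo [2 pi] to some [l], so that the translates of the character tend to
[x |-> exp(i (theta(x) + l))], and translating back undoes this rotation. *)

(** * Subnets from compactness *)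

Section subnet.
Variables (T : topologicalType) (D : directedType) (v : D -> T) (l : T).
Hypothesis clv : cluster (v d @[d --> dir_tails D]) l.

(** The index set of the usual subnet converging to a cluster point: pairs of an
index of the net and a neighborhood of [l] that contains its value there. *)
Definition cluster_index : Type :=
  {p : D * set T | nbhs l p.2 /\ p.2 (v p.1)}.

Definition cluster_le (p q : cluster_index) : Prop :=
  dir_le (sval p).1 (sval q).1 /\ (sval q).2 `<=` (sval p).2.

Lemma cluster_index_ex (d : D) (A : set T) :
  nbhs l A -> exists p : cluster_index, dir_le d (sval p).1 /\ (sval p).2 = A.
Proof.
move=> lA; have [|_ [[e de <-] Ae]] :=
  clv (A := v @` [set e | dir_le d e]) _ lA.
  by exists d => e de; exists e.
by exists (exist _ (e, A) (conj lA Ae)).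
Qed.

Lemma cluster_inhabited : inhabited cluster_index.
Proof.
case: (dir_inhabited D) => d.
by have [p _] := cluster_index_ex d filterT; constructor.
Qed.

Lemma cluster_refl p : cluster_le p p.
Proof. by split => //; exact: dir_refl. Qed.

Lemma cluster_trans p q r :
  cluster_le p q -> cluster_le q r -> cluster_le p r.
Proof.
move=> [pq qp] [qr rq]; split; first exact: dir_trans qr.
exact: subset_trans qp.
Qed.

Lemma cluster_ub p q : exists r, cluster_le p r /\ cluster_le q r.
Proof.
have [d [pd qd]] := dir_ub (sval p).1 (sval q).1.
have [r [dr rE]] := cluster_index_ex d
  (filterI (proj1 (svalP p)) (proj1 (svalP q))).
exists r; rewrite /cluster_le rE.
by split; (split; [exact: dir_trans dr|move=> x []]).
Qed.

Definition cluster_net : directedType :=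
  DirectedType cluster_inhabited cluster_refl cluster_trans cluster_ub.

Lemma cluster_subnet : exists (D' : directedType) (h : D' -> D),
  cofinal h /\ v (h d) @[d --> dir_tails D'] --> l.
Proof.
exists cluster_net, (fun p => (sval p).1); split.
  move=> d; have [p [dp _]] := cluster_index_ex d filterT.
  by exists p => q [pq _]; exact: dir_trans pq.
move=> A lA; case: (dir_inhabited D) => d.
have [p [_ pA]] := cluster_index_ex d lA.
by exists p => q [_]; rewrite pA; apply; exact: (proj2 (svalP q)).
Qed.

End subnet.

Lemma compact_subnet (T : topologicalType) (K : set T) (D : directedType)
    (v : D -> T) : compact K -> (forall d, K (v d)) ->
  exists (D' : directedType) (h : D' -> D) (l : T),
    cofinal h /\ v (h d) @[d --> dir_tails D'] --> l.
Proof.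
move=> cK Kv; have [|l [_ /cluster_subnet[D' [h H]]]] :=
  cK (v d @[d --> dir_tails D]) _.
  exact: (@filterE _ (dir_tails D)).
by exists D', h, l.
Qed.

(** * The complex exponential of an imaginary number *)

Section circle.
Variable R : realType.
Implicit Types a b : R.

Definition expi a : R[i] := cos a +i* sin a.

Lemma expiD a b : expi (a + b) = expi a * expi b.
Proof.
by rewrite /expi cosD sinD; simpc; rewrite [sin a * _ + _]addrC.
Qed.

Lemma expi_pi : expi pi = -1.
Proof.
by rewrite /expi cospi sinpi; apply/eqP; rewrite eq_complex /= oppr0 !eqxx.
Qed.

Lemma norm_expi a : `|expi a| = 1.
Proof. by rewrite normc_def /= cos2Dsin2 sqrtr1. Qed.

Lemma expi_periodic (n : int) a : expi (a + n%:~R * (pi *+ 2)) = expi a.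
Proof.
have nat_periodic (m : nat) b : expi (b + m%:R * (pi *+ 2)) = expi b.
  have e2 : expi (pi *+ 2) = 1 by rewrite mulr2n expiD expi_pi mulrNN mulr1.
  elim: m b => [|m IH] b; first by rewrite mul0r addr0.
  by rewrite -natr1 mulrDl mul1r addrA expiD IH e2 mulr1.
case: n => m; first exact: nat_periodic.
by rewrite NegzE mulrNz mulNr -[LHS](nat_periodic m.+1) subrK.
Qed.

Lemma real_complex_continuous : continuous (fun a => a%:C : R[i]).
Proof.
move=> a; apply/(@cvgrPdist_lt _ _ _ (nbhs a)) => e e0.
have eE : e = (complex.Re e)%:C by rewrite RRe_real// ger0_real// ltW.
have e0' : 0 < complex.Re e by rewrite -ltcR -eE.
have : \forall b \near a, `|a - b| < complex.Re e.
  exact: (@cvgr_dist_lt _ _ _ (nbhs a) _ id a cvg_id _ e0').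
apply: filterS => b; rewrite -ltcR -eE.
by rewrite -rmorphB normc_def /= expr0n addr0 sqrtr_sqr.
Qed.

Lemma expi_continuous : continuous expi.
Proof.
move=> a; have -> : expi = (fun b => (cos b)%:C + 'i * (sin b)%:C).
  by apply/funext => b; rewrite /expi; simpc.
apply: cvgD.
  by apply: continuous_comp; [exact: continuous_cos|exact: real_complex_continuous].
apply: cvgM; first exact: cvg_cst.
by apply: continuous_comp; [exact: continuous_sin|exact: real_complex_continuous].
Qed.

(** Phases matter modulo [2 pi], so the floor of [a / (2 pi)] moves any of them
into a compact interval. *)
Lemma phase_reduction a : exists2 b, b \in `[0, pi *+ 2] &
  exists n : int, a = b + n%:~R * (pi *+ 2).
Proof.
have p0 : 0 < pi *+ 2 :> R by rewrite mulrn_wgt0// pi_gt0.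
set n := Num.floor (a / (pi *+ 2)).
exists (a - n%:~R * (pi *+ 2)); last by exists n; rewrite subrK.
have na : n%:~R <= a / (pi *+ 2) by exact: floor_le.
have an : a / (pi *+ 2) < (n + 1)%:~R by exact: floorD1_gt.
rewrite in_itv /= subr_ge0 -ler_pdivlMr// na /= lerBlDr.
rewrite -[X in X + _]mul1r -mulrDl -ler_pdivrMr// addrC.
by rewrite (ltW (lt_le_trans an _))// intrD.
Qed.

End circle.

(** * Characters and the action *)

Section character.
Variables (R : realType) (G : topologicalZmodType) (theta : G -> R).
Hypothesis thetaD : forall x y, theta (x + y) = theta x + theta y.
Hypothesis thetaC : continuous theta.

Let chi (x : G) : R[i] := expi (theta x).

Let thetaB x y : theta (x - y) = theta x - theta y.
Proof. by apply/eqP; rewrite eq_sym subr_eq -thetaD subrK. Qed.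

(** A subnet is taken along which the phase, reduced to [[0, 2 pi]], converges.
Working with phases rather than with points of the circle makes the two limits
instances of the continuity of [expi]. *)
Lemma left_aa_character : left_aa chi.
Proof.
move=> D u.
have /choice[r rP] (d : D) : exists b : R, `[0, pi *+ 2]%classic b /\
    exists n : int, theta (u d) = b + n%:~R * (pi *+ 2).
  by have [b b2 bn] := phase_reduction (theta (u d)); exists b.
have [D' [h [l [hc rl]]]] :=
  compact_subnet (@segment_compact _ 0 (pi *+ 2)) (fun d => proj1 (rP d)).
exists D', h, (fun x => expi (theta x + l)); split; [exact: hc| | |].
- move=> x; apply: (@continuous_comp _ _ _ (fun y => theta y + l) (@expi R)).
    by apply: cvgD; [exact: thetaC|exact: cvg_cst].
  exact: expi_continuous.
- apply/ptws_cvgP => x.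
  have -> : (fun d => rtrans (u (h d)) chi x) =
      (fun d => expi (theta x + r (h d))).
    apply/funext => d; rewrite /rtrans /chi thetaD.
    by have [_ [n ->]] := rP (h d); rewrite addrA expi_periodic.
  apply: continuous_cvg; first exact: expi_continuous.
  by apply: cvgD => //; exact: cvg_cst.
- apply/ptws_cvgP => x.
  have -> : (fun d => rtrans (- u (h d)) (fun x => expi (theta x + l)) x) =
      (fun d => expi (theta x + (l - r (h d)))).
    apply/funext => d; rewrite /rtrans thetaB.
    have [_ [n ->]] := rP (h d).
    rewrite -[LHS](expi_periodic n); congr expi.
    rewrite opprD !addrA.
    by rewrite [LHS]addrAC subrK addrAC.
  have -> : chi x = expi (theta x + (l - l)) by rewrite subrr addr0.
  apply: continuous_cvg; first exact: expi_continuous.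
  by apply: cvgD; [exact: cvg_cst|apply: cvgB => //; exact: cvg_cst].
Qed.

(** Multiplicativity makes [|chi(t + x) - chi(s + x)|] independent of [x]. *)
Lemma LUC_character : LUC chi.
Proof.
have chiC : continuous chi.
  by move=> x; apply: continuous_comp; [exact: thetaC|exact: expi_continuous].
split=> //.
  by apply/bounded_funC; exists 1 => x; rewrite norm_expi.
move=> D u t ut; apply/uniform_cvgP => e e0.
have cu : chi (u d) @[d --> dir_tails D] --> chi t.
  exact: (cvg_comp _ _ ut (chiC t)).
have : \forall d \near dir_tails D, `|chi t - chi (u d)| < e.
  exact: (@cvgr_dist_lt _ _ _ _ _ _ _ cu).
apply: filterS => d Hd x.
by rewrite /ltrans /chi !thetaD !expiD -mulrBl normrM norm_expi mulr1.
Qed.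

Lemma character_aa_luc : chi \in @aa_luc_pred R G.
Proof. by apply/asboolP; split; [exact: left_aa_character|exact: LUC_character]. Qed.

Definition character : aa_luc R G := AALuc character_aa_luc.

End character.

Section action.
Variables (R : realType) (G : topologicalZmodType).

Lemma dual_app_continuous (f : aa_luc R G) :
  continuous (fun mu : aa_dual R G => mu f).
Proof.
move=> mu; apply: (@continuous_comp _ _ _
  (set_val : aa_dual R G -> {ptws aa_luc R G -> R[i]}) (fun m => m f)).
  exact: initial_continuous.
exact: proj_continuous.
Qed.

(** A functional in [M_a] takes at [f] a value in the closure of the range of
[f], which here lies on the unit circle. *)
Lemma M_a_neq0 (f : aa_luc R G) (mu : aa_dual R G) :
  (forall x, `|f x| = 1) -> M_a mu -> mu f != 0.
Proof.
move=> f1 Mmu; apply/eqP => mu0.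
have : \forall nu \near mu, `|mu f - dual_app nu f| < 1.
  apply: (@cvgr_dist_lt _ _ _ (nbhs mu) _ (fun nu => dual_app nu f) (mu f)) => //.
  exact: dual_app_continuous.
by move=> /Mmu [_ [[s _ <-]]]; rewrite /= mu0 sub0r normrN f1 ltxx.
Qed.

Lemma dual_act_neq (t : G) (theta : G -> R) :
  (forall x y, theta (x + y) = theta x + theta y) -> continuous theta ->
  theta t = pi -> forall mu : aa_dual R G, M_a mu -> dual_act t mu <> mu.
Proof.
move=> thetaD thetaC thetat mu Mmu fixed.
set f := character thetaD thetaC.
have ftN : aa_ltrans t f = - f.
  apply/val_inj/funext => x.
  by rewrite /= /ltrans thetaD expiD thetat expi_pi mulN1r.
have muN : mu (- f) = - mu f.
  have [muL _] := dualP mu.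
  have mu0 : mu 0 = 0.
    by have := muL (-1) 0 0; rewrite scaler0 addr0 scaleN1r addNr.
  by have := muL (-1) f 0; rewrite addr0 mu0 addr0 !scaleN1r.
have f1 x : `|f x| = 1 by exact: norm_expi.
have : mu f = - mu f by rewrite -muN -ftN -[in LHS]fixed.
move/eqP; rewrite -addr_eq0 -mulr2n mulrn_eq0 /=.
by apply/negP; exact: M_a_neq0.
Qed.

End action.

Theorem mainTheorem4 (R : realType) :
  (forall x : aa_dual R (discrete_topology int), M_a x ->
     forall t : discrete_topology int, t <> 0 -> dual_act t x <> x) /\
  (forall x : aa_dual R R, M_a x ->
     forall t : R, t <> 0 -> dual_act t x <> x).
Proof.
split=> mu Mmu t /eqP t0.
- pose theta (n : discrete_topology int) : R :=
    (n : int)%:~R * (pi / (t : int)%:~R).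
  apply: (@dual_act_neq _ _ t theta) => //.
  + by move=> m n; rewrite /theta -mulrDl -intrD.
  + move=> n A /nbhs_singleton/= An.
    by apply: (filterS _ (discrete_set1 n)) => _ ->.
  + by rewrite /theta mulrC divfK// intr_eq0.
- apply: (@dual_act_neq _ _ t (fun x => x * (pi / t))) => //.
  + by move=> x y; rewrite mulrDl.
  + by move=> x; apply: cvgM; [exact: cvg_id|exact: cvg_cst].
  + by rewrite mulrC divfK.
Qed.
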